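(* Let $X=(0,+\infty)$ with the metric $d$ induced from the Euclidean line $\mathbb R$, and equip $X$ with the metric uniform structure $\mathcal K_d$. For each $n\in\mathbb Z$ let $f_n:X\to X$, $f_n(x)=x^n$. Let $T=\{f_n:n\in\mathbb Z\}$, a semigroup under composition acting on $X$ by evaluation, and let $\mathcal I=\mathcal P(\{f_{-n}:n\ge 1\})$, the ideal on $T$ of all subsets of $\{f_{-n}:n\geq 1\}$. Then the transformation semigroup $(T,X)$ is expansive but is not $\mathcal I$-expansive.
   Context: A transformation semigroup $(T,X)$ consists of a topological space $X$, a discrete semigroup $T$ with identity $e$, and a continuous action $T\times X\to X$, $(t,x)\mapsto tx$, with $ex=x$ and $(ts)x=t(sx)$. An ideal on $T$ is a nonempty collection of subsets of $T$ closed under finite unions and under taking subsets. $\mathcal K_d$ is the collection of all $\alpha\subseteq X\times X$ that contain $\{(x,y):d(x,y)<\varepsilon\}$ for some $\varepsilon>0$. For a uniform structure $\mathcal K$ on $X$ and an ideal $\mathcal J$ on $T$, $(T,(X,\mathcal K))$ is $\mathcal J$-expansive if there exists $\alpha\in\mathcal K$ such that for all distinct $x,y\in X$ and all $E\in\mathcal J$ there exists $t\in T\setminus E$ with $(tx,ty)\notin\alpha$. It is expansive if it is $\{\varnothing\}$-expansive. *)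

(* Defs.v *)
From HB Require Import structures.
From mathcomp Require Import all_boot all_order all_algebra.
From mathcomp Require Import all_classical all_reals all_analysis.

Set Implicit Arguments.
Unset Strict Implicit.
Unset Printing Implicit Defensive.

Import Order.TTheory GRing.Theory Num.Theory.
Import numFieldTopology.Exports numFieldNormedType.Exports.

Local Open Scope classical_set_scope.
Local Open Scope ring_scope.

(* The semigroup [T] is discrete: joint continuity of the action is required
   for the discrete topology on [T]. *)
Record transformation_semigroup (T : monoidType) (X : topologicalType) :=
  TransformationSemigroup {
    ts_act :> T -> X -> X ;
    ts_act1 : forall x, ts_act 1%g x = x ;
    ts_actM : forall t s x, ts_act (t * s)%g x = ts_act t (ts_act s x) ;
    ts_act_continuous :
      continuous (fun p : discrete_topology T * X => ts_act p.1 p.2) }.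

Record ideal (T : Type) := Ideal {
  ideal_sets : set (set T) ;
  ideal_nonempty : ideal_sets !=set0 ;
  ideal_setU : forall A B, ideal_sets A -> ideal_sets B ->
    ideal_sets (A `|` B) ;
  ideal_subset : forall A B, B `<=` A -> ideal_sets A -> ideal_sets B }.

Section ideals.
Variable T : Type.

Lemma powerset_nonempty (A : set T) : [set B | B `<=` A] !=set0.
Proof. by exists set0 => x. Qed.

Lemma powerset_setU (A B C : set T) :
  [set D | D `<=` A] B -> [set D | D `<=` A] C -> [set D | D `<=` A] (B `|` C).
Proof. by move=> BA CA x [/BA|/CA]. Qed.

Lemma powerset_subset (A B C : set T) :
  C `<=` B -> [set D | D `<=` A] B -> [set D | D `<=` A] C.
Proof. exact: subset_trans. Qed.

Definition powerset_ideal (A : set T) : ideal T :=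
  Ideal (powerset_nonempty A) (@powerset_setU A) (@powerset_subset A).

Lemma trivial_nonempty : [set (set0 : set T)] !=set0.
Proof. by exists set0. Qed.

Lemma trivial_setU (B C : set T) : [set (set0 : set T)] B ->
  [set (set0 : set T)] C -> [set (set0 : set T)] (B `|` C).
Proof. by move=> -> ->; rewrite /= setU0. Qed.

Lemma trivial_subset (B C : set T) :
  C `<=` B -> [set (set0 : set T)] B -> [set (set0 : set T)] C.
Proof. by move=> CB B0; move: CB; rewrite B0 subset0. Qed.

Definition trivial_ideal : ideal T :=
  Ideal trivial_nonempty trivial_setU trivial_subset.

End ideals.

(* The uniform structure is the one carried by [X]; its members are the sets
   satisfying [entourage]. *)
Definition J_expansive (T : monoidType) (X : uniformType)
    (phi : transformation_semigroup T X) (J : ideal T) : Prop :=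
  exists2 alpha : set (X * X), entourage alpha &
    forall x y : X, x <> y -> forall E : set T, ideal_sets J E ->
      exists2 t : T, ~ E t & ~ alpha (phi t x, phi t y).

Definition expansive (T : monoidType) (X : uniformType)
    (phi : transformation_semigroup T X) : Prop :=
  J_expansive phi (trivial_ideal T).

Section powers.
Variable R : realType.

(* As a subtype of [R], it inherits the topology, the uniform structure and the
   pseudometric structure induced by the inclusion. *)
Definition posreal : Type := [set x : R | 0 < x].

HB.instance Definition _ := PseudoMetric.on posreal.

Definition posreal_dist (x y : posreal) : R := `|val x - val y|.

Lemma posreal_dist_ge0 x y : 0 <= posreal_dist x y.
Proof. exact: normr_ge0. Qed.

Lemma posreal_dist_positivity x y : posreal_dist x y = 0 -> x = y.
Proof. by move/normr0_eq0/eqP; rewrite subr_eq0 => /eqP/val_inj. Qed.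

Lemma posreal_ballE (x : posreal) (e : R) :
  ball x e = [set y | posreal_dist x y < e].
Proof. by []. Qed.

HB.instance Definition _ := PseudoMetric_isMetric.Build R posreal
  posreal_dist_ge0 posreal_dist_positivity posreal_ballE.

(* The uniform structure of [posreal] is the metric one. *)
Lemma posreal_entourageE (alpha : set (posreal * posreal)) :
  entourage alpha <->
  exists2 e : R, 0 < e & [set p | `|val p.1 - val p.2| < e] `<=` alpha.
Proof. by rewrite -entourage_ballE. Qed.

Lemma pow_subproof (n : int) (x : posreal) :
  (val x ^ n) \in [set y : R | 0 < y].
Proof. by apply/mem_set => /=; apply: exprz_gt0; exact: (set_valP x). Qed.

Definition pow (n : int) (x : posreal) : posreal := SigSub (pow_subproof n x).

Definition powers : Type := range pow.

HB.instance Definition _ := Choice.on powers.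

Lemma powf_subproof (n : int) : pow n \in range pow.
Proof. by apply/mem_set; exists n. Qed.

(* [pow n] seen as an element of [powers] *)
Definition powf (n : int) : powers := SigSub (powf_subproof n).

Lemma pow_comp (m n : int) : pow m \o pow n = pow (n * m).
Proof. by apply/funext => x; apply/val_inj; rewrite /= exprz_exp. Qed.

Lemma pow1 : pow 1 = id.
Proof. by apply/funext => x; apply/val_inj; rewrite /= expr1z. Qed.

Lemma powers_mul_subproof (s t : powers) : val s \o val t \in range pow.
Proof.
have [m _ <-] := set_valP s; have [n _ <-] := set_valP t.
by rewrite pow_comp powf_subproof.
Qed.

Definition powers_mul (s t : powers) : powers :=
  SigSub (powers_mul_subproof s t).

Lemma powers_one_subproof : id \in range pow.
Proof. by rewrite -pow1 powf_subproof. Qed.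

Definition powers_one : powers := SigSub powers_one_subproof.

Lemma powers_mulA : associative powers_mul.
Proof. by move=> s t u; apply/val_inj. Qed.

Lemma powers_mul1g : left_id powers_one powers_mul.
Proof. by move=> s; apply/val_inj. Qed.

Lemma powers_mulg1 : right_id powers_one powers_mul.
Proof. by move=> s; apply/val_inj. Qed.

HB.instance Definition _ := isMonoid.Build powers
  powers_mulA powers_mul1g powers_mulg1.

Definition powers_act (t : powers) (x : posreal) : posreal := val t x.

Lemma powers_act1 (x : posreal) : powers_act 1%g x = x.
Proof. by []. Qed.

Lemma powers_actM (s t : powers) (x : posreal) :
  powers_act (s * t)%g x = powers_act s (powers_act t x).
Proof. by []. Qed.

Lemma pow_continuous (n : int) : continuous (pow n).
Proof.
have cv : continuous (fun x : posreal => val x : R).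
  exact: initial_continuous.
suff cn : continuous (fun x : posreal => (val x ^ n : R)).
  by apply: (@continuous_comp_initial posreal posreal R val (pow n)).
move=> x; have x0 : val x != 0 by apply/lt0r_neq0; exact: (set_valP x).
suff c : {for val x, continuous (fun y : R => y ^ n)}.
  exact: (continuous_comp (cv x) c).
case: n => n; first exact: exprn_continuous.
apply: (@continuousV _ _ (fun y : R => y ^+ n.+1)); first by rewrite expf_neq0.
exact: exprn_continuous.
Qed.

Lemma powers_act_continuous :
  continuous (fun p : discrete_topology powers * posreal => powers_act p.1 p.2).
Proof.
move=> [t x] A /=.
have [n _ tE] := set_valP t.
rewrite /powers_act /= -tE => /(pow_continuous (n := n)) Ax.
exists ([set t : discrete_topology powers], pow n @^-1` A) => /=.
  by split; [exact: discrete_set1|].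
by move=> [s y] /= [-> Ay]; rewrite -tE.
Qed.

Definition power_ts : transformation_semigroup powers posreal :=
  TransformationSemigroup powers_act1 powers_actM powers_act_continuous.

Definition neg_power_ideal : ideal powers :=
  powerset_ideal [set t | exists2 n : nat, (1 <= n)%N & t = powf (- n%:Z)].

End powers.

(* Main.v *)
(** The entourage [d < 1] witnesses expansiveness: if [x < y] and [1 < y], then
[y ^ (n+1) - x ^ (n+1) >= (y - x) * y ^ n] is unbounded, and if [x < y <= 1] the
same applies to [y^-1 < x^-1], that is, to the negative powers. Only nonnegative
powers are available outside the set of all [f_{-n}] with [n >= 1]; these map
[(0, r)] with [r <= 1] into itself or to the point [1], so two points below
[min(1, e)] are never separated by the entourage [d < e]. *)

Require Import Defs.
From mathcomp Require Import all_boot all_order all_algebra.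
From mathcomp Require Import all_classical all_reals all_analysis.
From mathcomp Require Import lra.

Set Implicit Arguments.
Unset Strict Implicit.
Unset Printing Implicit Defensive.

Import Order.TTheory GRing.Theory Num.Theory.

Local Open Scope classical_set_scope.
Local Open Scope ring_scope.

Lemma bernoulli_ineq (R : realFieldType) (y : R) (n : nat) :
  1 <= y -> 1 + n%:R * (y - 1) <= y ^+ n.
Proof.
move=> y1; elim: n => [|n IHn]; first by rewrite mul0r addr0 expr0.
have n0 : 0 <= n%:R :> R by [].
have := ler_wpM2l (le_trans ler01 y1) IHn.
(* This is the surplus of y (1 + n (y - 1)) over 1 + (n + 1)(y - 1). *)
have : 0 <= n%:R * (y - 1) * (y - 1) by rewrite !mulr_ge0 ?subr_ge0.
rewrite exprS -natr1; nra.
Qed.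

Lemma pow_separates (R : archiRealFieldType) (x y : R) :
  0 < x -> x < y -> 1 < y -> exists n : nat, 1 <= y ^+ n - x ^+ n.
Proof.
move=> x0 xy y1.
have d0 : 0 < y - x by rewrite subr_gt0.
have c0 : 0 < (y - x) * (y - 1) by rewrite mulr_gt0 ?subr_gt0.
(* By Archimedes n (y - x)(y - 1) > 1, so Bernoulli gives (y - x) y^n >= 1. *)
pose n := Num.bound ((y - x) * (y - 1))^-1.
have hn : 1 < n%:R * ((y - x) * (y - 1)).
  rewrite -ltr_pdivrMr // div1r.
  by apply: archi_boundP; rewrite invr_ge0 ltW.
exists n.+1.
have := ler_wpM2l (ltW d0) (bernoulli_ineq n (ltW y1)).
have : x * x ^+ n <= x * y ^+ n.
  by rewrite ler_pM2l // lerXn2r ?nnegrE //; lra.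
rewrite !exprS; nra.
Qed.

Lemma powers_separates (R : realType) (x y : posreal R) :
  val x < val y -> exists m : int, 1 <= `|val x ^ m - val y ^ m|.
Proof.
move=> xy.
have x0 : 0 < val x by exact: (set_valP x).
have y0 : 0 < val y by exact: (set_valP y).
have [y1|y1] := ltP 1 (val y).
  have [n hn] := pow_separates x0 xy y1.
  by exists n%:Z; rewrite distrC; exact: le_trans hn (ler_norm _).
(* Here x < y <= 1, so inversion swaps the order and x^-1 > 1. *)
have [|||n hn] := @pow_separates R (val y)^-1 (val x)^-1.
- by rewrite invr_gt0.
- by rewrite ltf_pV2.
- by rewrite invf_gt1 // (lt_le_trans xy).
by exists (- n%:Z); rewrite -!exprz_inv; exact: le_trans hn (ler_norm _).
Qed.

Lemma expansive_power_ts (R : realType) : expansive (power_ts R).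
Proof.
exists [set p | `|val p.1 - val p.2| < 1].
  by apply/posreal_entourageE; exists 1.
(* [E] is empty, so negative exponents are admissible too. *)
move=> x y xy _ ->.
have [m hm] : exists m : int, 1 <= `|val x ^ m - val y ^ m|.
  have : val x != val y by apply/eqP => /val_inj.
  rewrite neq_lt => /orP[/powers_separates//|/powers_separates[m hm]].
  by exists m; rewrite distrC.
by exists (powf R m) => //=; apply/negP; rewrite -leNgt.
Qed.

(** For n >= 1, z^n <= z on (0, r) keeps both powers in an interval of length at most e; for n = 0
    they coincide. *)
Lemma dist_expr_lt (R : realFieldType) (e r x y : R) (n : nat) :
  r <= 1 -> r <= e -> 0 < x < r -> 0 < y < r -> `|x ^+ n - y ^+ n| < e.
Proof.
move=> r1 re /andP[x0 xr] /andP[y0 yr].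
case: n => [|n]; first by rewrite !expr0 subrr normr0; lra.
have exprW (z : R) : 0 < z -> z < r -> 0 < z ^+ n.+1 < r.
  move=> z0 zr; rewrite exprn_gt0 //= (le_lt_trans _ zr) //.
  by rewrite exprS ler_piMr ?exprn_ile1 //; lra.
have := exprW _ x0 xr; have := exprW _ y0 yr.
by rewrite ltr_norml; lra.
Qed.

Lemma not_neg_power_expansive (R : realType) :
  ~ J_expansive (power_ts R) (neg_power_ideal R).
Proof.
case=> alpha /posreal_entourageE[e e0 ealpha] sep.
pose r := Num.min 1 e.
have r0 : 0 < r by rewrite lt_min ltr01.
have r1 : r <= 1 by rewrite ge_min lexx.
have re : r <= e by rewrite ge_min lexx orbT.
have x0 : r / 2 \in [set z : R | 0 < z] by apply/mem_set => /=; lra.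
have y0 : r / 3 \in [set z : R | 0 < z] by apply/mem_set => /=; lra.
pose x : posreal R := SigSub x0; pose y : posreal R := SigSub y0.
have xy : x <> y by move=> /(congr1 val) /= ?; lra.
(* Test against the largest member of the ideal: all negative powers. *)
have [t] := sep x y xy _ (@subset_refl _ _).
have [m _ tE] := set_valP t.
have -> : t = powf R m by apply/val_inj.
(* [Negz n] is -(n + 1), whose power lies in the excluded set. *)
case: m {tE} => n nE; last by case: nE; exists n.+1.
apply; apply: ealpha => /=.
by apply: (dist_expr_lt _ r1 re); apply/andP; split; lra.
Qed.

Theorem mainTheorem2 (R : realType) :
  expansive (power_ts R) /\ ~ J_expansive (power_ts R) (neg_power_ideal R).
Proof. by split; [exact: expansive_power_ts | exact: not_neg_power_expansive]. Qed.
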